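(* The separative regular rings form a subvariety of the variety of regular rings with inner inverse operation, in the following sense. For a (von Neumann) regular ring $R$ with inner inverse operation $'$ and parameters $a,b,c,d\in R$, put $$e:=dd'+d(1-dd'),$$ $$x_e:=\bigl(1-eae(eae)'\bigr)\,ebeaece\,\bigl(1-(eae)'eae\bigr)+(1-e).$$ Consider the identity $$x_e'\,x_e''\,x_e''\,x_e'=1\qquad\text{for all } a,b,c,d\in R. \quad( * )$$ If $(R,\,')$ satisfies $( * )$, then $R$ is separative; and conversely every separative regular ring $R$ admits an inner inverse operation $'$ for which $( * )$ holds.
   Context: Rings are associative and unital. A ring $R$ is (von Neumann) regular if every $a\in R$ has an inner inverse, i.e. some $b\in R$ with $aba=a$. An inner inverse operation on a regular ring $R$ is a map $'\colon R\to R$ with $aa'a=a$ for all $a\in R$; $a''$ means $(a')'$. The variety of regular rings has the signature of unital rings together with one additional unary operation $'$, and its identities are those of unital rings together with $aa'a=a$; a subvariety is a variety with the same signature satisfying these identities and possibly additional ones. $\mathrm{FP}(R)$ denotes the category of finitely generated projective right $R$-modules. A regular ring $R$ is separative if for all $A,B,C\in\mathrm{FP}(R)$, $A\oplus C\oplus C\cong B\oplus C\oplus C$ implies $A\oplus C\cong B\oplus C$ (equivalently, $A\oplus A\cong A\oplus B\cong B\oplus B$ implies $A\cong B$ for all $A,B\in\mathrm{FP}(R)$). *)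

(* Defs.v *)
From HB Require Import structures.
From mathcomp Require Import all_boot all_order all_algebra.

Set Implicit Arguments.
Unset Strict Implicit.
Unset Printing Implicit Defensive.

Import GRing.Theory.
Local Open Scope ring_scope.

(* Rings are [pzRingType]s, so that the zero ring is allowed. *)

Definition regular_ring (R : pzRingType) : Prop :=
  forall a : R, exists b : R, a * b * a = a.

Definition inner_inverse_op (R : pzRingType) (inv : R -> R) : Prop :=
  forall a : R, a * inv a * a = a.

Definition finitely_generated (S : pzRingType) (M : lmodType S) : Prop :=
  exists (n : nat) (g : 'I_n -> M),
    forall x : M, exists k : 'I_n -> S, x = \sum_(i < n) k i *: g i.

Definition projective (S : pzRingType) (P : lmodType S) : Prop :=
  forall (M N : lmodType S) (p : {linear M -> N}) (f : {linear P -> N}),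
    (forall y : N, exists x : M, p x = y) ->
    exists h : {linear P -> M}, forall x : P, p (h x) = f x.

Definition isomorphic (S : pzRingType) (M N : lmodType S) : Prop :=
  exists f : {linear M -> N}, bijective f.

(* A right R-module is a left module over the converse ring R^c: the right    *)
(* action of a on m is (a : R^c) *: m.                                        *)
Definition FP (R : pzRingType) (M : lmodType R^c) : Prop :=
  finitely_generated M /\ projective M.

(* The direct sum of two modules is their product type, with its componentwise *)
(* module structure.                                                          *)
Definition separative (R : pzRingType) : Prop :=
  forall A B C : lmodType R^c, FP A -> FP B -> FP C ->
    isomorphic (A * C * C)%type (B * C * C)%type ->
    isomorphic (A * C)%type (B * C)%type.

(* For an inner inverse operation, [idem inv d] is idempotent, and every      *)
(* idempotent is of this form.                                                *)
Definition idem (R : pzRingType) (inv : R -> R) (d : R) : R :=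
  d * inv d + d * (1 - d * inv d).

Definition xelt (R : pzRingType) (inv : R -> R) (a b c d : R) : R :=
  let e := idem inv d in
  let f := e * a * e in
  (1 - f * inv f) * (e * b * e * a * e * c * e) * (1 - inv f * f) + (1 - e).

Definition separativity_identity (R : pzRingType) (inv : R -> R) : Prop :=
  forall a b c d : R,
    let x := xelt inv a b c d in
    inv x * inv (inv x) * inv (inv x) * inv x = 1.

(* Main.v *)
From HB Require Import structures.
From Stdlib Require Import Setoid Morphisms ClassicalEpsilon.
Require Import Defs.
From mathcomp Require Import all_boot all_order all_algebra.

Set Implicit Arguments.
Unset Strict Implicit.
Unset Printing Implicit Defensive.

Import GRing.Theory.
Local Open Scope ring_scope.

(** Call x unit-regular if x u x = x for some unit u; over a regular ring
    this says that the kernel and the cokernel of left multiplication by x are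
    isomorphic.  If [inv x * inv (inv x) * inv (inv x) * inv x = 1] then
    [inv x] is left and right invertible; conversely, if [u = inv x] is a unit
    then the equation [u * inv u * u = u] forces [inv u] to be the inverse of
    [u], so the product is 1.  Hence (R, inv) satisfies the identity exactly
    when [inv] sends each of the elements [xelt inv a b c d] to a unit, and
    some choice of [inv] achieves this as soon as all these elements are
    unit-regular, whatever [inv] was used to form them.

    Let e be an idempotent, and let a, b, c lie in eRe.  Then a splits eR as
    K + I, with K its kernel, and as K' + aR, with K' its cokernel and aR
    isomorphic to I.  Up to units, the element x attached to a, b, c is 1 - e
    plus a map K -> K' that factors through I, so the image J of that map is
    isomorphic to a summand of I = J + L.  Write K = K0 + J and K' = K0' + J.
    The kernel of x is K0 + L + J and its cokernel is K0' + L + J, and adding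
    one more J to either of them gives eR.  Separativity, applied to K0 + L,
    K0' + L and J, cancels this J: this is [separative_xelt_unit_regular].

    Conversely, an isomorphism of A + C + C with B + C + C is of this kind as
    soon as A + C + C is a summand of R: for suitable a, b, c the kernel of x
    is A + C and its cokernel is B + C, so that the identity gives the wanted
    cancellation ([identity_cancellation_below_self]).  General modules need
    not fit inside R.  The classes of finitely generated projective modules
    form, however, a refinement monoid ([regular_hom_refinement]), and in such
    a monoid the whole cancellation problem reduces to elements below a given
    generator ([cancel_small], [cancellation_from_below_self]). *)

(** * Cancellation in refinement monoids *)

(** A commutative monoid is given here by operations on representatives, with
    [=~] in the role of equality: its elements will be modules up to
    isomorphism, for which no quotient type has to be formed. *)
Section RefinementMonoid.

Variables (T : Type) (eqv : T -> T -> Prop) (add : T -> T -> T).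
Local Infix "=~" := eqv (at level 70).
Local Infix "+" := add.
Hypothesis eqv_equiv : Equivalence eqv.
Hypothesis add_proper : Proper (eqv ==> eqv ==> eqv) add.
Hypothesis addC : forall a b, a + b =~ b + a.
Hypothesis addA : forall a b c, a + (b + c) =~ a + b + c.
Hypothesis refinement : forall a1 a2 b1 b2, a1 + a2 =~ b1 + b2 ->
  exists d11 d12 d21 d22, a1 =~ d11 + d12 /\ a2 =~ d21 + d22 /\
                          b1 =~ d11 + d21 /\ b2 =~ d12 + d22.

Let eqvxx a : a =~ a. Proof. reflexivity. Qed.
#[local] Hint Resolve eqvxx : core.

Definition below c d := exists z, c + z =~ d.

#[export] Instance below_proper : Proper (eqv ==> eqv ==> iff) below.
Proof.
by move=> a a' aE b b' bE; split=> [] [x xE]; exists x;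
  [rewrite -aE xE bE | rewrite aE xE bE].
Qed.

Let addAC a b c : a + b + c =~ a + c + b.
Proof. by rewrite -addA (addC b) addA. Qed.

Lemma below_trans a b c : below a b -> below b c -> below a c.
Proof. by move=> [x <-] [y <-]; exists (x + y); rewrite addA. Qed.

Lemma below_addr a b c : below a b -> below a (b + c).
Proof. by move=> [x <-]; exists (x + c); rewrite addA. Qed.

Lemma below_split c a b : below c (a + b) ->
  exists x y, c =~ x + y /\ below x a /\ below y b.
Proof.
move=> [z /refinement[x [y [x' [y' [cE [_ [aE bE]]]]]]]].
by exists x, y; split=> //; split; [exists x' | exists y']; symmetry.
Qed.

(** The 2 x 2 refinement matrix of an equation a + c = b + c: its rows d, a1
    and b1, c1 have sums a and c, its columns d, b1 and a1, c1 have sums b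
    and c. *)
Definition refines a b c d a1 b1 c1 :=
  a =~ d + a1 /\ b =~ d + b1 /\ c =~ a1 + c1 /\ c =~ b1 + c1.

Lemma refinesC a b c d a1 b1 c1 :
  refines a b c d a1 b1 c1 -> refines b a c d b1 a1 c1.
Proof. by move=> [? [? [? ?]]]. Qed.

(** A part x of the corner c1 that is also a part of d may be moved from the
    diagonal of the matrix to both off-diagonal entries.  Since c1 lies below
    a = d + a1, removing its part below d leaves a corner below a1. *)
Lemma refines_shrink a b c d a1 b1 c1 :
  refines a b c d a1 b1 c1 -> below c a ->
  exists d' a1' b1' c1', refines a b c d' a1' b1' c1' /\
    below c1' a1' /\ below c1' c1 /\ below b1 b1'.
Proof.
move=> [aE [bE [cE cE']]] ca.
have c1c : below c1 c by exists a1; rewrite addC -cE.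
have /below_split[x [y [c1E [[d' dE] ya1]]]] : below c1 (d + a1).
  by rewrite -aE; exact: below_trans ca.
exists d', (a1 + x), (b1 + x), y; split.
  split; first by rewrite aE -dE (addC x) -addA (addC x).
  split; first by rewrite bE -dE (addC x) -addA (addC x).
  by split; [rewrite cE c1E addA | rewrite cE' c1E addA].
split; first exact: below_addr.
by split; [exists x; rewrite c1E addC | exists x].
Qed.

Variable U : T.
Hypothesis cancel_below : forall a b c,
  a + c + c =~ b + c + c -> below (a + c + c) U -> a + c =~ b + c.

(** After shrinking the corner c1 of a refinement matrix below both a1 and b1,
    the equation a1 + c1 = b1 + c1 takes place inside c, hence below U, however
    large a and b are; and cancelling c1 there gives a = d + a1 = d + b1 = b. *)
Lemma cancel_small a b c :
  a + c =~ b + c -> below c a -> below c b -> below c U -> a =~ b.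
Proof.
move=> /refinement[d [a1 [b1 [c1 [aE [cE [bE cE']]]]]]] ca cb cU.
have /refines_shrink/(_ ca) : refines a b c d a1 b1 c1 by [].
move=> [d' [a2 [b2 [c2 [ref2 [c2a2 _]]]]]].
have [d3 [b3 [a3 [c3 [/refinesC ref3 [c3b3 [c3c2 a2a3]]]]]]] :=
  refines_shrink (refinesC ref2) cb.
have c3a3 : below c3 a3.
  exact: below_trans (below_trans c3c2 c2a2) a2a3.
move: ref3 c3a3 c3b3 => [aE3 [bE3 [cE3 cE3']]] [s sE] [t tE].
suff ab3 : a3 =~ b3 by rewrite aE3 bE3 ab3.
rewrite -sE -tE (addC c3 s) (addC c3 t).
have sc : c =~ s + c3 + c3 by rewrite cE3 -sE (addC c3 s).
apply: cancel_below.
  by rewrite -sc cE3' -tE (addC c3 t).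
by case: cU => z zE; exists z; rewrite -sc.
Qed.

Definition cancellable c :=
  forall a b, a + c + c =~ b + c + c -> a + c =~ b + c.

Lemma cancellable_below_unit c : below c U -> cancellable c.
Proof.
move=> cU a b abc; apply: cancel_small abc _ _ cU.
  by exists a; rewrite addC.
by exists b; rewrite addC.
Qed.

Lemma cancellable_below_add u v :
    (forall c, below c u -> cancellable c) ->
    (forall c, below c v -> cancellable c) ->
  forall c, below c (u + v) -> cancellable c.
Proof.
move=> cu cv c /below_split[x [y [cE [/cu cx /cv cy]]]] a b.
rewrite cE => ab.
rewrite !addA; apply: cy.
rewrite -!(addA _ y y) !(addAC _ x (y + y)).
apply: cx; move: ab.
by rewrite !addA -!(addA _ y y) !(addAC _ y x) -!(addA _ y y)
  !(addAC _ (y + y) x).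
Qed.

End RefinementMonoid.

(** * Linear maps, kernels and direct sums *)

Section LinearMaps.

Variables (S : pzRingType).

Section Pair.

Variables (M N P : lmodType S) (f : {linear P -> M}) (g : {linear P -> N}).

Definition pair_lin (x : P) : M * N := (f x, g x).

Lemma pair_lin_linear : linear pair_lin.
Proof. by move=> k x y; rewrite /pair_lin !linearP. Qed.

HB.instance Definition _ :=
  GRing.isLinear.Build S P (M * N)%type *:%R pair_lin pair_lin_linear.

End Pair.

Section ScaleAt.

Variables (M : lmodType S) (u : M).

Definition scale_at (x : S^o) : M := (x : S) *: u.

Lemma scale_at_linear : linear scale_at.
Proof. by move=> k x y; rewrite /scale_at scalerDl -scalerA. Qed.

HB.instance Definition _ :=
  GRing.isLinear.Build S S^o M *:%R scale_at scale_at_linear.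

End ScaleAt.

Lemma linear_scale_at (M : lmodType S) (f : {linear S^o -> M}) (x : S) :
  f x = scale_at (f 1) x.
Proof. by rewrite -[x in LHS]mulr1 linearZ. Qed.

Section Kernel.

Variables (M N : lmodType S) (f : {linear M -> N}).

Definition ker_pred : {pred M} := [pred x | f x == 0].

Lemma ker_submod : GRing.submod_closed ker_pred.
Proof.
split=> [|k x y]; rewrite !inE ?linear0 // => /eqP fx /eqP fy.
by rewrite linearP fx fy scaler0 addr0.
Qed.

HB.instance Definition _ := GRing.isSubmodClosed.Build S M ker_pred ker_submod.

Record kernel := Kernel { ker_val :> M; _ : ker_val \in ker_pred }.

HB.instance Definition _ := [isSub for ker_val].
HB.instance Definition _ := [Choice of kernel by <:].
HB.instance Definition _ := [SubChoice_isSubLmodule of kernel by <:].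

Lemma kerP (x : kernel) : f (val x) = 0.
Proof. by case: x => x fx; apply/eqP. Qed.

Section ToKernel.

Variables (P : lmodType S) (h : {linear P -> M}) (fh : forall x, f (h x) = 0).

Definition to_ker (x : P) : kernel := Kernel (introT eqP (fh x)).

Lemma to_ker_linear : linear to_ker.
Proof. by move=> k x y; apply: val_inj; rewrite /= linearP. Qed.

HB.instance Definition _ :=
  GRing.isLinear.Build S P kernel *:%R to_ker to_ker_linear.

End ToKernel.

End Kernel.

End LinearMaps.

(** A constant for the module structure on the product type, so that rewriting
    with isomorphisms has a head symbol to work on. *)
Definition dsum (S : pzRingType) (M N : lmodType S) : lmodType S :=
  (M * N)%type.

Local Infix "(+)" := dsum (at level 50, left associativity).

Section Modules.

Variable S : pzRingType.
Implicit Types M N P A B C Z : lmodType S.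

Lemma isomorphicP M N :
  isomorphic M N <-> exists (f : {linear M -> N}) (g : {linear N -> M}),
    cancel f g /\ cancel g f.
Proof.
split=> [[f [g fK gK]]|[f [g [fK gK]]]]; last by exists f, g.
pose g' := HB.pack_for {linear N -> M} g
  (GRing.isLinear.Build S N M *:%R g (can2_linear fK gK)).
by exists f, g'.
Qed.

Lemma isomorphicI M N (f : {linear M -> N}) (g : N -> M) :
  cancel f g -> cancel g f -> isomorphic M N.
Proof. by exists f, g. Qed.

#[export] Instance isomorphic_equiv : Equivalence (@isomorphic S).
Proof.
split.
- by move=> M; exists idfun, idfun.
- by move=> M N /isomorphicP[f [g [fK gK]]]; exists g, f.
- by move=> M N P [f fb] [g gb]; exists (g \o f); apply: bij_comp.
Qed.

#[export] Instance dsum_isomorphic :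
  Proper (@isomorphic S ==> @isomorphic S ==> @isomorphic S) (@dsum S).
Proof.
move=> M M' [f [f' fK f'K]] N N' [g [g' gK g'K]].
apply: (@isomorphicI _ _ (pair_lin (f \o fst) (g \o snd))
                         (fun x => (f' x.1, g' x.2))).
- by move=> [x y]; rewrite /= fK gK.
- by move=> [x y]; congr pair; [exact: f'K | exact: g'K].
Qed.

Lemma dsum_isoC M N : isomorphic (M (+) N) (N (+) M).
Proof. by exists (pair_lin snd fst), (pair_lin snd fst) => -[]. Qed.

Lemma dsum_isoA M N P : isomorphic (M (+) (N (+) P)) (M (+) N (+) P).
Proof.
exists (pair_lin (pair_lin fst (fst \o snd)) (snd \o snd)).
by exists (fun x => (x.1.1, (x.1.2, x.2))) => [[? []]|[[]]].
Qed.

Lemma retract_split M A (i : {linear A -> M}) (r : {linear M -> A}) :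
  cancel i r -> isomorphic M (A (+) kernel r).
Proof.
move=> iK.
have rk x : r ((idfun \- (i \o r)) x) = 0 by rewrite linearB /= iK subrr.
apply: (@isomorphicI _ _ (pair_lin r (to_ker rk)) (fun y => i y.1 + val y.2)).
  by move=> x; rewrite /= addrC subrK.
move=> [a x]; congr pair; first by rewrite linearD /= iK kerP addr0.
by apply: val_inj; rewrite /= linearD /= iK kerP addr0 addrAC subrr add0r.
Qed.

Definition retract A M :=
  exists (i : {linear A -> M}) (r : {linear M -> A}), cancel i r.

Lemma retract_trans A B C : retract A B -> retract B C -> retract A C.
Proof.
move=> [i [r iK]] [j [s jK]].
by exists (j \o i), (r \o s); move=> x; rewrite /= jK iK.
Qed.

Lemma retractP A M : retract A M <-> exists Z, isomorphic (A (+) Z) M.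
Proof.
split=> [[i [r iK]]|[Z /isomorphicP[f [g [fK gK]]]]].
  by exists (kernel r); symmetry; apply: retract_split iK.
exists (f \o pair_lin idfun \0), (fst \o g) => x.
by rewrite /= fK.
Qed.

(** * Regularity of homomorphisms and refinement *)

Definition regular_hom M N :=
  forall f : {linear M -> N}, exists g : {linear N -> M},
    forall x, f (g (f x)) = f x.

Lemma regular_hom_retract M M' N N' : retract M' M -> retract N' N ->
  regular_hom M N -> regular_hom M' N'.
Proof.
move=> [i [r iK]] [j [s jK]] regMN f.
have [g gE] := regMN (j \o f \o r).
exists (r \o g \o j) => x /=.
by have := gE (i x); rewrite /= iK => /(can_inj jK).
Qed.

(** Gaussian elimination: with f = (f1, f2), the map p projects away the image
    of f1, and the image of f is the sum of those of f1 and of p f2. *)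
Lemma regular_hom_dsuml M1 M2 N : regular_hom M1 N -> regular_hom M2 N ->
  regular_hom (M1 (+) M2) N.
Proof.
move=> reg1 reg2 f.
have [f1 f1E] : exists f1 : {linear M1 -> N}, forall x, f1 x = f (x, 0).
  by exists (f \o pair_lin idfun \0).
have [f2 f2E] : exists f2 : {linear M2 -> N}, forall x, f2 x = f (0, x).
  by exists (f \o pair_lin \0 idfun).
have fE x : f x = f1 x.1 + f2 x.2.
  rewrite f1E f2E -linearD; congr (f _).
  by rewrite -[RHS]/(_ + _, _ + _) /= addr0 add0r; case: x.
have [g1 g1E] := reg1 f1.
have [p pE] : exists p : {linear N -> N}, forall x, p x = x - f1 (g1 x).
  by exists (idfun \- (f1 \o g1)).
have pf1 x : p (f1 x) = 0 by rewrite pE g1E subrr.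
have [k kE] := reg2 (p \o f2).
exists (pair_lin (g1 \o (idfun \- (f2 \o k \o p))) (k \o p)) => x.
rewrite [RHS]fE [LHS]fE /= -fE.
set t := k (p _).
have pt : p (f2 t) = p (f x).
  by rewrite /t fE linearD pf1 add0r; exact: kE.
have := subrr (p (f x)); rewrite -{2}pt -linearB pE => /eqP.
by rewrite subr_eq0 => /eqP <-; rewrite subrK.
Qed.

Lemma regular_hom_dsumr M N1 N2 : regular_hom M N1 -> regular_hom M N2 ->
  regular_hom M (N1 (+) N2).
Proof.
move=> reg1 reg2 f.
have [f1 f1E] : exists f1 : {linear M -> N1}, forall x, f1 x = (f x).1.
  by exists (fst \o f).
have [f2 f2E] : exists f2 : {linear M -> N2}, forall x, f2 x = (f x).2.
  by exists (snd \o f).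
have [g1 g1E] := reg1 f1.
have [q qE] : exists q : {linear M -> M}, forall x, q x = x - g1 (f1 x).
  by exists (idfun \- (g1 \o f1)).
have [k kE] := reg2 (f2 \o q).
exists ((g1 \o fst) \+ (q \o k \o (snd \- (f2 \o g1 \o fst)))) => x.
set y := (X in f X).
have yE : y = g1 (f1 x) + q (k (f2 (q x)))
  by rewrite /y /= -f1E -f2E (qE x) (linearB f2).
rewrite yE [LHS]surjective_pairing [RHS]surjective_pairing.
congr pair.
  by rewrite -!f1E linearD g1E [q _]qE linearB g1E subrr addr0.
by rewrite -!f2E linearD [X in _ + X]kE /= qE linearB addrC subrK.
Qed.

(** Let P = A1 + A2 = B1 + B2 and let f1, f2 be the projections to A2 along A1,
    restricted to B1 and B2.  The image of f1 is the range of an idempotent e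
    of A2; so A2 is the sum of e A2, which is a quotient of B1, and of
    (1 - e) A2, which is a quotient of B2 as f1 and f2 together are onto.  Both
    quotients split.  Finally A1 is the kernel of (f1, f2), and adding
    g (f2 b2) to the first component of its elements (b1, b2) turns it into
    the sum of the kernels of the maps B1 -> e A2 and B2 -> (1 - e) A2. *)
Lemma regular_hom_refinement A1 A2 B1 B2 : regular_hom B1 A2 ->
    isomorphic (A1 (+) A2) (B1 (+) B2) ->
  exists D11 D12 D21 D22 : lmodType S,
    isomorphic A1 (D11 (+) D12) /\ isomorphic A2 (D21 (+) D22) /\
    isomorphic B1 (D11 (+) D21) /\ isomorphic B2 (D12 (+) D22).
Proof.
move=> reg /isomorphicP[s [r [sK rK]]].
have [f1 f1E] : exists f1 : {linear B1 -> A2}, forall x, f1 x = (r (x, 0)).2.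
  by exists (snd \o r \o pair_lin idfun \0).
have [f2 f2E] : exists f2 : {linear B2 -> A2}, forall x, f2 x = (r (0, x)).2.
  by exists (snd \o r \o pair_lin \0 idfun).
have fE x : (r x).2 = f1 x.1 + f2 x.2.
  rewrite f1E f2E -!linearD /=; congr (r _).2.
  by rewrite -[RHS]/(_ + _, _ + _) /= addr0 add0r -surjective_pairing.
have [g g_inv] := reg f1.
have [e eE] : exists e : {linear A2 -> A2}, forall x, e x = f1 (g x).
  by exists (f1 \o g).
have [e' e'E] : exists e' : {linear A2 -> A2}, forall x, e' x = x - e x.
  by exists (idfun \- e).
have ee x : e (e x) = e x by rewrite !eE g_inv.
have e'f1 x : e' (f1 x) = 0 by rewrite e'E eE g_inv subrr.
have ee' x : e (e' x) = 0 by rewrite e'E linearB ee subrr.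
have e'e x : e' (e x) = 0 by rewrite e'E ee subrr.
have e'f2 (x : B2) : e ((e' \o f2) x) = 0 by rewrite /= ee'.
pose r1 := to_ker e'f1.
pose r2 := to_ker e'f2.
exists (kernel r1), (kernel r2), (kernel e'), (kernel e).
have r1K (x : kernel r1) : f1 (val x) = 0 by have /(congr1 val) := kerP x.
have r2K (x : kernel r2) : f1 (g (f2 (val x))) = f2 (val x).
  have /(congr1 val)/= /eqP := kerP x.
  by rewrite e'E subr_eq0 -eE => /eqP.
have eK (x : kernel e') : e (val x) = val x.
  by have /eqP := kerP x; rewrite e'E subr_eq0 => /eqP.
have e'K (x : kernel e) : e' (val x) = val x by rewrite e'E kerP subr0.
split; [|split; [|split]].
- have [b1 b1E] : exists b : {linear A1 -> B1}, forall x, b x = (s (x, 0)).1.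
    by exists (fst \o s \o pair_lin idfun \0).
  have [b2 b2E] : exists b : {linear A1 -> B2}, forall x, b x = (s (x, 0)).2.
    by exists (snd \o s \o pair_lin idfun \0).
  have f12 x : f1 (b1 x) = - f2 (b2 x).
    apply/eqP; rewrite -addr_eq0 -[_ + _](fE (b1 x, b2 x)).
    by rewrite b1E b2E -surjective_pairing sK.
  have k1 x : r1 ((b1 \- (g \o f1 \o b1)) x) = 0.
    by apply: val_inj; rewrite /= linearB /= g_inv subrr.
  have k2 x : r2 (b2 x) = 0.
    by apply: val_inj; rewrite /= -[f2 _]opprK -f12 linearN e'f1 oppr0.
  pose back (y : kernel r1 * kernel r2) :=
    (val y.1 - g (f2 (val y.2)), val y.2) : B1 * B2.
  have back2 y : (r (back y)).2 = 0.
    by rewrite fE /= linearB r1K r2K sub0r addrC subrr.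
  apply: (@isomorphicI _ _ (pair_lin (to_ker k1) (to_ker k2))
    (fun y => (r (back y)).1)).
    move=> x; rewrite /back /= f12 !linearN /= opprK addrK.
    by rewrite b1E b2E -surjective_pairing sK.
  move=> y.
  have sE : s ((r (back y)).1, 0) = back y.
    by rewrite -[X in (_, X)](back2 y) -surjective_pairing rK.
  have b1y : b1 (r (back y)).1 = val y.1 - g (f2 (val y.2)) by rewrite b1E sE.
  have b2y : b2 (r (back y)).1 = val y.2 by rewrite b2E sE.
  rewrite [RHS]surjective_pairing; congr pair; apply: val_inj => //=.
  by rewrite f12 b2y b1y !linearN opprK subrK.
- apply: (@isomorphicI _ _ (pair_lin (to_ker e'e) (to_ker ee'))
    (fun y => val y.1 + val y.2)).
    by move=> x; rewrite /= e'E addrC subrK.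
  move=> [x y]; congr pair; apply: val_inj; rewrite [LHS]linearD /=.
    by rewrite eK kerP addr0.
  by rewrite kerP e'K add0r.
- rewrite dsum_isoC; apply: (retract_split (i := g \o val)) => x.
  by apply: val_inj; rewrite /= -eE eK.
- rewrite dsum_isoC.
  apply: (retract_split (i := snd \o s \o pair_lin \0 idfun \o val)) => x.
  apply: val_inj => /=.
  have : e' (r (s (0, val x))).2 = val x by rewrite sK e'K.
  by rewrite fE linearD e'f1 add0r.
Qed.

End Modules.

(** * Finitely generated projective modules over a regular ring *)

Section FGProj.

Variable S : pzRingType.
Implicit Types M N P A B C Z : lmodType S.

(** Free of rank n + 1: starting at rank one avoids the zero module. *)
Fixpoint free_module n : lmodType S :=
  if n is m.+1 then (S^o (+) free_module m) else S^o.

Definition fg_projective M := exists n, retract M (free_module n).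

Lemma free_combination M (g : nat -> M) n :
  exists f : {linear free_module n -> M}, forall k : nat -> S,
    exists v, f v = \sum_(i < n.+1) k i *: g i.
Proof.
elim: n => [|n [f fE]].
  by exists (scale_at (g 0)) => k; exists (k 0); rewrite big_ord1.
exists ((scale_at (g n.+1) \o fst) \+ (f \o snd)) => k.
have [v vE] := fE k; exists (k n.+1, v).
by rewrite /= vE [RHS]big_ord_recr addrC.
Qed.

Lemma FP_fg_projective M :
  finitely_generated M -> projective M -> fg_projective M.
Proof.
move=> [n [g gM]] projM; exists n.
pose g' i := if insub i is Some j then g j else 0.
have [f fE] := free_combination g' n.
have [x|h hK] := projM _ _ f idfun; last by exists h, f => x; exact: hK.
have [k ->] := gM x.
have [v vE] := fE (fun i => if insub i is Some j then k j else 0).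
exists v; rewrite vE big_ord_recr /= [X in _ + X](_ : _ = 0) ?addr0; last first.
  by rewrite insubF ?ltnn // scale0r.
by apply: eq_bigr => i _; rewrite /g' valK.
Qed.

Lemma fg_projective_retract M N :
  retract M N -> fg_projective N -> fg_projective M.
Proof. by move=> MN [n /(retract_trans MN) Mn]; exists n. Qed.

Lemma retract_isomorphic M N : isomorphic M N -> retract M N.
Proof. by move=> /isomorphicP[f [g [fK _]]]; exists f, g. Qed.

Lemma retract_fst M N : retract M (M (+) N).
Proof. by apply/retractP; exists N; reflexivity. Qed.

Lemma retract_snd M N : retract N (M (+) N).
Proof. by apply/retractP; exists M; exact: dsum_isoC. Qed.

Lemma free_dsum m n :
  isomorphic (free_module m (+) free_module n) (free_module (m + n).+1).
Proof.
elim: m => [|m IHm] /=; first reflexivity.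
by rewrite -dsum_isoA IHm; reflexivity.
Qed.

Lemma fg_projective_dsum M N : fg_projective M -> fg_projective N ->
  fg_projective (M (+) N).
Proof.
move=> [m /retractP[Z Zm]] [n /retractP[Y Yn]]; exists (m + n).+1.
apply/retractP; exists (Z (+) Y).
rewrite -free_dsum -Zm -Yn.
rewrite !dsum_isoA -(dsum_isoA M Z N) (dsum_isoC Z N) !dsum_isoA.
reflexivity.
Qed.

Lemma regular_self : regular_ring S -> regular_hom S^o S^o.
Proof.
move=> regS f; have [b bE] := regS (f 1); exists (scale_at (b : S^o)) => x.
have fE (y : S) : f y = y * f 1 := linear_scale_at f y.
rewrite (fE (scale_at (b : S^o) (f x))) (fE x).
change ((x : S) * f 1 * b * f 1 = (x : S) * f 1).
by rewrite -[in RHS]bE !mulrA.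
Qed.

Lemma regular_free : regular_ring S ->
  forall m n, regular_hom (free_module m) (free_module n).
Proof.
move=> /regular_self regS.
have reg1 n : regular_hom S^o (free_module n).
  by elim: n => [|n IHn] //=; apply: regular_hom_dsumr.
by elim=> [|m IHm] n //=; apply: regular_hom_dsuml.
Qed.

Lemma regular_fg_projective M N : regular_ring S ->
  fg_projective M -> fg_projective N -> regular_hom M N.
Proof.
move=> regS [m Mm] [n Nn].
exact: regular_hom_retract Mm Nn (@regular_free regS m n).
Qed.

Record fgproj := FgProj { carrier :> lmodType S; _ : fg_projective carrier }.

Definition fgproj_eqv (X Y : fgproj) := isomorphic X Y.

Definition fgproj_sum (X Y : fgproj) : fgproj :=
  let: FgProj M fM := X in let: FgProj N fN := Y in
  FgProj (fg_projective_dsum fM fN).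

Definition fgproj_self : fgproj :=
  @FgProj S^o (ex_intro (fun n => retract S^o (free_module n)) 0%N
    (retract_isomorphic (reflexivity _))).

Lemma fgproj_sumE X Y : (fgproj_sum X Y : lmodType S) = X (+) Y.
Proof. by case: X Y => [M fM] [N fN]. Qed.

#[export] Instance fgproj_eqv_equiv : Equivalence fgproj_eqv.
Proof.
by rewrite /fgproj_eqv; split=> [X|X Y XY|X Y Z XY YZ];
  [reflexivity | symmetry | transitivity Y].
Qed.

#[export] Instance fgproj_sum_proper :
  Proper (fgproj_eqv ==> fgproj_eqv ==> fgproj_eqv) fgproj_sum.
Proof.
move=> X X' XX' Y Y' YY'; rewrite /fgproj_eqv !fgproj_sumE.
exact: dsum_isomorphic.
Qed.

Lemma fgproj_sumC X Y : fgproj_eqv (fgproj_sum X Y) (fgproj_sum Y X).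
Proof. by rewrite /fgproj_eqv !fgproj_sumE; exact: dsum_isoC. Qed.

Lemma fgproj_sumA (X Y Z : fgproj) : fgproj_eqv (fgproj_sum X (fgproj_sum Y Z))
  (fgproj_sum (fgproj_sum X Y) Z).
Proof. by rewrite /fgproj_eqv !fgproj_sumE; exact: dsum_isoA. Qed.

Lemma fg_projective_iso M N : isomorphic M N -> fg_projective N ->
  fg_projective M.
Proof. by move=> /retract_isomorphic; exact: fg_projective_retract. Qed.

Lemma fgproj_refinement : regular_ring S -> forall A1 A2 B1 B2 : fgproj,
  fgproj_eqv (fgproj_sum A1 A2) (fgproj_sum B1 B2) ->
  exists D11 D12 D21 D22,
    fgproj_eqv A1 (fgproj_sum D11 D12) /\ fgproj_eqv A2 (fgproj_sum D21 D22) /\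
    fgproj_eqv B1 (fgproj_sum D11 D21) /\ fgproj_eqv B2 (fgproj_sum D12 D22).
Proof.
move=> regS [A1 fA1] [A2 fA2] [B1 fB1] [B2 fB2].
rewrite /fgproj_eqv !fgproj_sumE /=.
have reg := regular_fg_projective regS fB1 fA2.
move=> /(regular_hom_refinement reg).
move=> [D11 [D12 [D21 [D22 [A1E [A2E [B1E B2E]]]]]]].
have fsum M N P : isomorphic P (M (+) N) -> fg_projective P ->
    fg_projective M /\ fg_projective N.
  move=> PE fP; have fMN : fg_projective (M (+) N).
    by apply: fg_projective_iso fP; symmetry.
  by split; apply: fg_projective_retract fMN;
    [exact: retract_fst | exact: retract_snd].
have [f11 f12] := fsum _ _ _ A1E fA1; have [f21 f22] := fsum _ _ _ A2E fA2.
by exists (FgProj f11), (FgProj f12), (FgProj f21), (FgProj f22).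
Qed.

(** A summand of a free module is, by refinement, a sum of summands of S, and
    these are cancelled one at a time. *)
Lemma cancellation_from_below_self : regular_ring S ->
  (forall A B C Z, isomorphic (A (+) C (+) C) (B (+) C (+) C) ->
     isomorphic (A (+) C (+) C (+) Z) S^o -> isomorphic (A (+) C) (B (+) C)) ->
  forall A B C, fg_projective A -> fg_projective B -> fg_projective C ->
    isomorphic (A (+) C (+) C) (B (+) C (+) C) ->
  isomorphic (A (+) C) (B (+) C).
Proof.
move=> regS sepU A B C fA fB fC.
have refS := fgproj_refinement regS.
have sepU' (X Y Z : fgproj) :
    fgproj_eqv (fgproj_sum (fgproj_sum X Z) Z)
               (fgproj_sum (fgproj_sum Y Z) Z) ->
    below fgproj_eqv fgproj_sum (fgproj_sum (fgproj_sum X Z) Z) fgproj_self ->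
    fgproj_eqv (fgproj_sum X Z) (fgproj_sum Y Z).
  rewrite /below /fgproj_eqv; move=> XYZ [W]; move: XYZ.
  by rewrite !fgproj_sumE; exact: sepU.
have cU (X : fgproj) : below fgproj_eqv fgproj_sum X fgproj_self ->
    cancellable fgproj_eqv fgproj_sum X.
  exact: (cancellable_below_unit fgproj_eqv_equiv fgproj_sum_proper fgproj_sumC
    fgproj_sumA refS sepU').
have free_fg n : fg_projective (free_module n).
  by exists n; apply: retract_isomorphic; reflexivity.
have cfree n : forall X : fgproj,
    below fgproj_eqv fgproj_sum X (FgProj (free_fg n)) ->
    cancellable fgproj_eqv fgproj_sum X.
  elim: n => [|n IHn] X; first exact: cU.
  move=> XS; apply: (cancellable_below_add fgproj_eqv_equiv fgproj_sum_proper
    fgproj_sumC fgproj_sumA refS cU IHn).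
  by case: XS => W; exists W.
have [n /retractP[Z Zn]] := fC.
have fZ : fg_projective Z.
  apply: fg_projective_retract (retract_snd C Z) _.
  exact: fg_projective_iso Zn (free_fg n).
have /(_ (FgProj fA) (FgProj fB)) := cfree n (FgProj fC)
  (ex_intro _ (FgProj fZ) Zn).
exact.
Qed.

End FGProj.

(** * Unit-regular elements *)

Section UnitRegular.

Variable R : pzRingType.
Implicit Types a b c d e f m n p q s t u v w x y z : R.

Definition unit_regular x :=
  exists u v, u * v = 1 /\ v * u = 1 /\ x * u * x = x.

Lemma unit_regular_conj x p p' q q' : p' * p = 1 -> p * p' = 1 ->
  q * q' = 1 -> q' * q = 1 -> unit_regular (p * x * q) -> unit_regular x.
Proof.
move=> p'p pp' qq' q'q [u [v [uv [vu E]]]].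
exists (q * u * p), (p' * v * q'); split; [|split].
- by rewrite !mulrA -[_ * p * p']mulrA pp' mulr1 -[q * u * v]mulrA uv mulr1.
- by rewrite !mulrA -[_ * q' * q]mulrA q'q mulr1 -[p' * v * u]mulrA vu mulr1.
- have /= := congr1 (fun z => p' * z * q') E; rewrite !mulrA p'p mul1r.
  by rewrite -(mulrA _ q q') qq' mulr1 -(mulrA x q q') qq' mulr1.
Qed.

Lemma square_zero_unit d : d * d = 0 ->
  (1 - d) * (1 + d) = 1 /\ (1 + d) * (1 - d) = 1.
Proof.
move=> dd; split.
  by rewrite mulrBl mul1r mulrDr mulr1 dd addr0 addrK.
by rewrite mulrDl mul1r mulrBr mulr1 dd subr0 subrK.
Qed.

(** Both 1 - m x and 1 - u x project onto the kernel of x, both 1 - x m and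
    1 - x u project along the image of x, and conjugation by u takes 1 - x u to
    1 - u x. *)
Lemma unit_regular_ker_coker x m : unit_regular x -> x * m * x = x ->
  exists s t, t * s = 1 - m * x /\ s * t = 1 - x * m.
Proof.
move=> [u [v [uv [vu xux]]]] xmx.
exists ((1 - x * m) * v * (1 - m * x)), ((1 - u * x) * u * (1 - x * m)).
have E1 : u * (1 - x * u) = (1 - u * x) * u.
  by rewrite mulrBr mulrBl mulr1 mul1r mulrA.
have E2 : (1 - x * u) * (1 - x * m) = 1 - x * u.
  by rewrite mulrBr mulr1 mulrA mulrBl mul1r xux subrr mul0r subr0.
have E3 : (1 - u * x) * (1 - m * x) = 1 - m * x.
  rewrite mulrBl mul1r mulrBr mulr1 -mulrA [x * (m * x)]mulrA xmx.
  by rewrite subrr subr0.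
have E4 : (1 - m * x) * (1 - u * x) = 1 - u * x.
  rewrite mulrBl mul1r mulrBr mulr1 -mulrA [x * (u * x)]mulrA xux.
  by rewrite subrr subr0.
have E5 : (1 - x * m) * (1 - x * u) = 1 - x * m.
  by rewrite mulrBr mulr1 mulrA mulrBl mul1r xmx subrr mul0r subr0.
have E6 : (1 - x * m) * (1 - x * m) = 1 - x * m.
  by rewrite {1}mulrBr mulr1 mulrA mulrBl mul1r xmx subrr mul0r subr0.
split.
  rewrite -E1 !mulrA -(mulrA u _ (1 - x * m)) E2 -(mulrA u _ (1 - x * m)) E2.
  by rewrite E1 -(mulrA _ u v) uv mulr1 E3.
rewrite !mulrA -(mulrA _ (1 - m * x)) E4 -(mulrA _ _ u) -E1 !mulrA.
by rewrite -(mulrA _ v u) vu mulr1 E5 E6.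
Qed.

(** The identity displays a left and a right inverse of [inv x]. *)
Lemma unit_regular_identity (inv : R -> R) : inner_inverse_op inv ->
  separativity_identity inv -> forall a b c d, unit_regular (xelt inv a b c d).
Proof.
move=> invP idP a b c d; have := idP a b c d; rewrite /=.
set x := xelt _ _ _ _ _; set u := inv x; set w := inv u => E.
have ur : u * (w * w * u) = 1 by rewrite !mulrA.
have ul : u * w * w * u = 1 by [].
have E' : w * w * u = u * w * w by rewrite -[LHS]mul1r -{1}ul -mulrA ur mulr1.
by exists u, (u * w * w); rewrite -{1}E' invP.
Qed.

(** The projections 1 - a a' and 1 - a m have the same kernel aR, so on eR they
    differ by a left factor 1 + d with d of square zero; likewise 1 - a' a and
    1 - m a have the same image and differ by such a factor on the right.  As
    n = (1 - a m) n (1 - m a), the inner inverse a' chosen by the operation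
    may be replaced by m. *)
Lemma unit_regular_change_inner_inverse e a a' m n :
  e * a = a -> a * e = a -> e * n = n -> n * e = n -> e * e = e ->
  a * a' * a = a -> a * m * a = a -> a * m * n = 0 -> n * m * a = 0 ->
  unit_regular ((1 - a * a') * n * (1 - a' * a) + (1 - e)) ->
  unit_regular (n + (1 - e)).
Proof.
move=> ea ae en ne ee aa'a ama amn nma.
pose w := m - a'.
have awa : a * w * a = 0 by rewrite mulrBr mulrBl ama aa'a subrr.
have [p'p pp'] : (1 - a * w * e) * (1 + a * w * e) = 1 /\
    (1 + a * w * e) * (1 - a * w * e) = 1.
  by apply: square_zero_unit; rewrite !mulrA -(mulrA _ e) ea awa !mul0r.
have [q'q qq'] : (1 - e * w * a) * (1 + e * w * a) = 1 /\
    (1 + e * w * a) * (1 - e * w * a) = 1.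
  apply: square_zero_unit; rewrite !mulrA -(mulrA _ a) ae.
  by rewrite -!mulrA [a * (w * a)]mulrA awa !mulr0.
suff -> : (1 - a * a') * n * (1 - a' * a) + (1 - e) =
    (1 + a * w * e) * (n + (1 - e)) * (1 + e * w * a).
  exact: unit_regular_conj p'p pp' qq' q'q.
have e1e : e * (1 - e) = 0 by rewrite mulrBr mulr1 ee subrr.
have e1e' : (1 - e) * e = 0 by rewrite mulrBl mul1r ee subrr.
rewrite (mulrDr _ n) (mulrDl (_ * n)); congr (_ + _).
  have -> : (1 + a * w * e) * n = (1 - a * a') * n.
    rewrite mulrDl mul1r -!mulrA en mulrBl mulrBr [a * (m * n)]mulrA amn.
    by rewrite sub0r [RHS]mulrBl mul1r -mulrA.
  rewrite -!mulrA; congr (_ * _).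
  rewrite [RHS]mulrDr mulr1 !mulrA ne [n * w]mulrBr mulrBl nma sub0r.
  by rewrite mulrBr mulr1 mulrA.
rewrite mulrDl mul1r -[_ * e * (1 - e)]mulrA e1e mulr0 addr0.
by rewrite mulrDr mulr1 !mulrA e1e' !mul0r addr0.
Qed.

(** Here s and t identify the kernel e - y' y of y in eRe with its cokernel
    e - y y'.  Adding t to y' and s to y makes them inverse to each other
    inside eRe. *)
Lemma unit_regular_complete e y y' s t : e * e = e ->
    e * y = y -> y * e = y -> e * y' = y' -> y' * e = y' ->
    y * y' * y = y -> y' * y * y' = y' ->
    t * s = e - y' * y -> s * t = e - y * y' ->
    (e - y * y') * s = s -> (e - y' * y) * t = t ->
  unit_regular (y + (1 - e)).
Proof.
move=> ee ey ye ey' y'e yy'y y'yy' ts st ls lt.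
have sr : s * (e - y' * y) = s by rewrite -ts mulrA st.
have tr : t * (e - y * y') = t by rewrite -st mulrA ts.
have e1e : e * (1 - e) = 0 by rewrite mulrBr mulr1 ee subrr.
have e1e' : (1 - e) * e = 0 by rewrite mulrBl mul1r ee subrr.
move fE : (1 - e) => f; rewrite fE in e1e e1e'.
have ff : f * f = f by rewrite -{2}fE mulrBr mulr1 e1e' subr0.
have fl z : e * z = z -> f * z = 0 by move=> <-; rewrite mulrA e1e' mul0r.
have fr z : z * e = z -> z * f = 0 by move=> <-; rewrite -mulrA e1e mulr0.
have es : e * s = s by rewrite -ls mulrA mulrBr ee mulrA ey.
have et : e * t = t by rewrite -lt mulrA mulrBr ee mulrA ey'.
have se : s * e = s by rewrite -sr -mulrA mulrBl ee -mulrA ye.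
have te : t * e = t by rewrite -tr -mulrA mulrBl ee -mulrA y'e.
have y's : y' * s = 0 by rewrite -ls mulrA mulrBr y'e mulrA y'yy' subrr mul0r.
have yt : y * t = 0 by rewrite -lt mulrA mulrBr ye mulrA yy'y subrr mul0r.
have sy' : s * y' = 0 by rewrite -sr -mulrA mulrBl ey' y'yy' subrr mulr0.
have ty : t * y = 0 by rewrite -tr -mulrA mulrBl ey yy'y subrr mulr0.
exists (y' + t + f), (y + s + f).
split; [|split].
- rewrite !(mulrDl _ _ (_ + f)) !(mulrDr _ _ f).
  rewrite !(mulrDr _ y) y's ty ts ff !fl // !fr // !addr0 !add0r.
  by rewrite -fE (addrC _ (e - _)) subrK addrC subrK.
- rewrite !(mulrDl _ _ (_ + f)) !(mulrDr _ _ f).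
  rewrite !(mulrDr _ y') yt sy' st ff !fl // !fr // !addr0 !add0r.
  by rewrite -fE (addrC _ (e - _)) subrK addrC subrK.
have -> : (y + f) * (y' + t + f) = y * y' + f.
  rewrite mulrDl !mulrDr yt (fl y') // (fl t) // (fr y) // ff.
  by rewrite !addr0 !add0r.
rewrite mulrDl !mulrDr yy'y (fl y) // ff add0r.
by rewrite -(mulrA y) (fr y') // mulr0 addr0.
Qed.

End UnitRegular.

(** * The modules pR *)

Section RightIdeals.

Variable R : pzRingType.
Implicit Types e p q s t x y : R.

Definition mulmap p : {linear (R^c)^o -> (R^c)^o} := scale_at (p : (R^c)^o).

(** As a kernel, pR is the module of the x with p x = x; p is meant to be
    idempotent, and left multiplications are the endomorphisms of R as a right
    R-module. *)
Definition rideal p : lmodType R^c := kernel (idfun \- mulmap p).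

Lemma ridealE p (x : rideal p) : p * (val x : R) = val x.
Proof. by have /eqP := kerP x; rewrite /= subr_eq0 => /eqP. Qed.

Lemma mem_rideal p (M : lmodType R^c) (h : {linear M -> (R^c)^o}) :
    (forall u : M, p * (h u : R) = h u) ->
  forall u : M, (idfun \- mulmap p) (h u) = 0.
Proof. by move=> ph x; rewrite /= -[X in _ - X]/(p * (h x : R)) ph subrr. Qed.

Lemma rideal_isomorphic p q s t : t * s = p -> s * t = q ->
  isomorphic (rideal p) (rideal q).
Proof.
move=> ts st.
have qs (x : rideal p) : q * ((mulmap s \o val) x : R) = (mulmap s \o val) x.
  change (q * (s * (val x : R)) = s * (val x : R)).
  by rewrite -st -!mulrA [t * (s * _)]mulrA ts ridealE.
have pt (x : rideal q) : p * ((mulmap t \o val) x : R) = (mulmap t \o val) x.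
  change (p * (t * (val x : R)) = t * (val x : R)).
  by rewrite -ts -!mulrA [s * (t * _)]mulrA st ridealE.
apply: (@isomorphicI _ _ _ (to_ker (mem_rideal qs)) (to_ker (mem_rideal pt))).
  move=> x; apply: val_inj; rewrite /= -[LHS]/(t * (s * (val x : R))).
  by rewrite mulrA ts ridealE.
move=> x; apply: val_inj; rewrite /= -[LHS]/(s * (t * (val x : R))).
by rewrite mulrA st ridealE.
Qed.

Lemma rideal_split p q : p * p = p -> q * q = q -> p * q = q -> q * p = q ->
  isomorphic (rideal p) (rideal q (+) rideal (p - q)).
Proof.
move=> pp qq pq qp.
have qi (x : rideal p) : q * ((mulmap q \o val) x : R) = (mulmap q \o val) x.
  by change (q * (q * (val x : R)) = q * (val x : R)); rewrite mulrA qq.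
have pqi (x : rideal p) :
    (p - q) * ((mulmap (p - q) \o val) x : R) = (mulmap (p - q) \o val) x.
  change ((p - q) * ((p - q) * (val x : R)) = (p - q) * (val x : R)).
  by rewrite mulrA mulrBl !mulrBr pp pq qp qq subrr subr0.
have pi (x : rideal q (+) rideal (p - q)) :
    p * (((val \o fst) \+ (val \o snd)) x : R) =
      ((val \o fst) \+ (val \o snd)) x.
  change (p * ((val x.1 : R) + val x.2) = (val x.1 : R) + val x.2).
  rewrite mulrDr -{1}(ridealE x.1) mulrA pq ridealE.
  by rewrite -{1}(ridealE x.2) mulrA mulrBr pp pq ridealE.
apply: (@isomorphicI _ _ _
  (pair_lin (to_ker (mem_rideal qi)) (to_ker (mem_rideal pqi)))
  (to_ker (mem_rideal pi))).
  move=> x; apply: val_inj.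
  rewrite /= -[LHS]/(q * (val x : R) + (p - q) * (val x : R)).
  by rewrite -mulrDl addrC subrK ridealE.
move=> [x y].
have qy : q * (val y : R) = 0.
  by rewrite -[val y]ridealE mulrA mulrBr qp qq subrr mul0r.
congr pair; apply: val_inj => /=.
  by rewrite -[LHS]/(q * ((val x : R) + val y)) mulrDr ridealE qy addr0.
rewrite -[LHS]/((p - q) * ((val x : R) + val y)) mulrDr ridealE.
by rewrite mulrBl -[val x]ridealE !mulrA pq qq subrr add0r.
Qed.

Lemma mulmap_idem p (pp : p * p = p) (x : R) :
  p * (mulmap p x : R) = mulmap p x.
Proof. by rewrite -[LHS]/(p * (p * x)) mulrA pp. Qed.

Definition rideal_gen p (pp : p * p = p) : rideal p :=
  to_ker (@mem_rideal p _ (mulmap p) (mulmap_idem pp)) (1 : R).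

Lemma val_rideal_gen p (pp : p * p = p) : val (rideal_gen pp) = p.
Proof. by rewrite /= -[LHS]/(p * 1) mulr1. Qed.

Lemma rideal_genE p (pp : p * p = p) (x : rideal p) :
  x = (val x : R^c) *: rideal_gen pp.
Proof.
apply: val_inj; change ((val x : R) = p * 1 * (val x : R)).
by rewrite mulr1 ridealE.
Qed.

(** The elements s and t are the images of the generators p and q. *)
Lemma isomorphic_rideal p q : p * p = p -> q * q = q ->
    isomorphic (rideal p) (rideal q) ->
  exists s t, [/\ t * s = p, s * t = q, q * s = s & p * t = t].
Proof.
move=> pp qq /isomorphicP[f [g [fK gK]]].
pose s : R := val (f (rideal_gen pp)); pose t : R := val (g (rideal_gen qq)).
have fE (x : rideal p) : (val (f x) : R) = s * (val x : R).
  by rewrite {1}(rideal_genE pp x) linearZ.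
have gE (x : rideal q) : (val (g x) : R) = t * (val x : R).
  by rewrite {1}(rideal_genE qq x) linearZ.
exists s, t; split; rewrite ?ridealE // -?gE -?fE ?fK ?gK;
  exact: val_rideal_gen.
Qed.

Lemma rideal_FP p : p * p = p -> FP (rideal p).
Proof.
move=> pp; split.
  exists 1%N, (fun=> rideal_gen pp) => x; exists (fun=> val x).
  by rewrite big_ord1 -rideal_genE.
move=> M N h f h_surj; have [m mE] := h_surj (f (rideal_gen pp)).
exists (scale_at m \o val) => x.
by rewrite [LHS]linearZ mE -linearZ -rideal_genE.
Qed.

End RightIdeals.

(** * From separativity to the identity *)

Section SeparativityImpliesIdentity.

Variable R : pzRingType.
Implicit Types a b c d e p q s t x y : R.

Lemma FP_dsum (M N : lmodType R^c) : FP M -> FP N -> FP (M (+) N).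
Proof.
move=> [[m [g gM]] projM] [[n [h hN]] projN]; split.
  exists (m + n)%N, (fun i => match split i with
    inl j => (g j, 0) | inr j => (0, h j) end) => -[x y].
  have [k ->] := gM x; have [l ->] := hN y.
  exists (fun i => match split i with inl j => k j | inr j => l j end).
  transitivity (pair_lin idfun \0 (\sum_(i < m) k i *: g i) +
                pair_lin \0 idfun (\sum_(i < n) l i *: h i) : M (+) N).
    by congr pair; rewrite /= ?addr0 ?add0r.
  rewrite !linear_sum big_split_ord /=; congr (_ + _); apply: eq_bigr => i _.
    by rewrite (unsplitK (inl i) : split (lshift n i) = _) linearZ.
  by rewrite (unsplitK (inr i) : split (rshift m i) = _) linearZ.
move=> X Y p f p_surj.
have [u uE] := projM X Y p (f \o pair_lin idfun \0) p_surj.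
have [v vE] := projN X Y p (f \o pair_lin \0 idfun) p_surj.
exists ((u \o fst) \+ (v \o snd)) => -[x y].
rewrite /= linearD uE vE /= -linearD; congr (f _).
by congr pair; rewrite /= ?addr0 ?add0r.
Qed.

Lemma compl_idempotent e p : e * e = e -> p * p = p -> e * p = p -> p * e = p ->
  [/\ (e - p) * (e - p) = e - p, e * (e - p) = e - p & (e - p) * e = e - p].
Proof.
move=> ee pp ep pe.
by split; rewrite ?mulrBl ?mulrBr ee ?pe ?ep ?pp ?subrr ?subr0.
Qed.

(** With m an inner inverse of a in eRe, let P = e - a m and Q = e - m a be the
    projections to the cokernel and the kernel of a, and let z be an inner
    inverse of y with j = z y below Q and j' = y z below P.  The idempotents j
    and j' give the image J of y, and J is also a summand hR of aR because y
    factors through a.  With K0, K0' and L the complements of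
    J in QR, PR and aR, the modules A = K0 + L and B = K0' + L satisfy
    A + J + J = eR = B + J + J, and A + J, B + J are isomorphic to the kernel
    and the cokernel of y in eR. *)
Lemma separative_xelt_unit_regular e a b c a' :
  regular_ring R -> separative R ->
  e * e = e -> e * a = a -> a * e = a -> e * b = b -> b * e = b ->
  e * c = c -> c * e = c -> a * a' * a = a ->
  unit_regular ((1 - a * a') * (b * a * c) * (1 - a' * a) + (1 - e)).
Proof.
move=> regR sepR ee ea ae eb be ec ce aa'a.
have [m mE] : exists m, m = e * a' * e by eexists.
have em : e * m = m by rewrite mE !mulrA ee.
have me : m * e = m by rewrite mE -mulrA ee.
have ama : a * m * a = a by rewrite mE !mulrA ae -mulrA ea.
have [P PE] : exists P, P = e - a * m by eexists.
have [Q QE] : exists Q, Q = e - m * a by eexists.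
have amam : a * m * (a * m) = a * m by rewrite mulrA ama.
have mama : m * a * (m * a) = m * a by rewrite -mulrA [a * _]mulrA ama.
have eam : e * (a * m) = a * m by rewrite mulrA ea.
have ame : a * m * e = a * m by rewrite -mulrA me.
have ema : e * (m * a) = m * a by rewrite mulrA em.
have mae : m * a * e = m * a by rewrite -mulrA ae.
have [PP eP Pe] := compl_idempotent ee amam eam ame.
have [QQ eQ Qe] := compl_idempotent ee mama ema mae.
rewrite -PE in PP eP Pe; rewrite -QE in QQ eQ Qe.
have [y yE] : exists y, y = P * (b * a * c) * Q by eexists.
have -> : (1 - a * a') * (b * a * c) * (1 - a' * a) = y.
  have eP' : (1 - a * a') * e = P by rewrite mulrBl mul1r PE mE !mulrA ae.
  have eQ' : e * (1 - a' * a) = Q by rewrite mulrBr mulr1 QE mE -!mulrA ea.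
  have ebac : b * a * c = e * (b * a * c) * e.
    by rewrite !mulrA eb -(mulrA _ c e) ce.
  rewrite ebac !mulrA eP' -(mulrA _ e (1 - a' * a)) eQ'.
  by rewrite yE !mulrA.
have aQ : a * Q = 0 by rewrite QE mulrBr ae mulrA ama subrr.
have Pa : P * a = 0 by rewrite PE mulrBl ea ama subrr.
have Py : P * y = y by rewrite yE !mulrA PP.
have yQ : y * Q = y by rewrite yE -[LHS]mulrA QQ.
(* Passing from z0 to z0 y z0 makes y an inner inverse of z as well. *)
have [z0 z0E] := regR y.
have [z zE] : exists z, z = Q * (z0 * y * z0) * P by eexists.
have Qz : Q * z = z by rewrite zE !mulrA QQ.
have zP : z * P = z by rewrite zE -[LHS]mulrA PP.
have yz : y * z * y = y.
  by rewrite zE !mulrA yQ -(mulrA _ P) Py z0E z0E.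
have z0yz0 : z0 * y * z0 * y * (z0 * y * z0) = z0 * y * z0.
  have z0y : z0 * y * z0 * y = z0 * y by rewrite -!mulrA (mulrA y) z0E.
  by rewrite z0y !mulrA z0y.
have zy : z * y * z = z.
  rewrite {1 2}zE -(mulrA _ P y) Py !mulrA -(mulrA _ y Q) yQ.
  by rewrite zE -[in RHS]z0yz0 !mulrA.
have ey : e * y = y by rewrite -Py mulrA eP.
have ye : y * e = y by rewrite -yQ -mulrA Qe.
have ez : e * z = z by rewrite -Qz mulrA eQ.
have ze : z * e = z by rewrite -zP -mulrA Pe.
pose j := z * y; pose j' := y * z.
pose h := a * c * z * (b * (a * m)).
have jj : j * j = j by rewrite mulrA zy.
have j'j' : j' * j' = j' by rewrite mulrA yz.
have Qj : Q * j = j by rewrite mulrA Qz.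
have jQ : j * Q = j by rewrite -mulrA yQ.
have Pj' : P * j' = j' by rewrite mulrA Py.
have j'P : j' * P = j' by rewrite -mulrA zP.
have zbacz : z * (b * a * c * z) = z.
  have -> : b * a * c * z = b * a * c * (Q * z) by rewrite Qz.
  by rewrite -{1}zP -mulrA (mulrA P) (mulrA _ Q z) -yE mulrA zy.
have amacz : a * m * (a * c * z) = a * c * z by rewrite !mulrA ama.
have bamacz : b * (a * m) * (a * c * z) = b * a * c * z.
  by rewrite -mulrA amacz !mulrA.
have hh : h * h = h.
  by rewrite /h -mulrA (mulrA (b * _)) bamacz mulrA -(mulrA _ z) zbacz.
have amh : a * m * h = h by rewrite /h mulrA amacz.
have ham : h * (a * m) = h by rewrite /h -(mulrA _ _ (a * m)) -(mulrA b) amam.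
(* The three modules isomorphic to J: jR in the kernel of a, j'R in its
   cokernel, and hR in its image. *)
have iso_j : isomorphic (rideal j) (rideal j').
  by apply: (rideal_isomorphic (s := y) (t := z)).
have iso_h : isomorphic (rideal h) (rideal j').
  apply: (rideal_isomorphic (s := P * b * (a * m)) (t := a * c * z)).
    by rewrite /h -(mulrA P b) [LHS]mulrA -(mulrA _ z P) zP.
  rewrite -(mulrA P b) -mulrA bamacz /j' yE -(mulrA _ Q z) Qz.
  by rewrite !mulrA.
have iso_a : isomorphic (rideal (a * m)) (rideal (m * a)).
  by apply: (rideal_isomorphic (s := m) (t := a)).
have split_Q := rideal_split QQ jj Qj jQ.
have split_P := rideal_split PP j'j' Pj' j'P.
have split_eQ := rideal_split ee mama ema mae.
have split_eP := rideal_split ee amam eam ame.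
have split_a := rideal_split amam hh amh ham.
have [kk _ _] := compl_idempotent QQ jj Qj jQ.
have [ll _ _] := compl_idempotent PP j'j' Pj' j'P.
have [nn _ _] := compl_idempotent amam hh amh ham.
pose A := rideal (Q - j) (+) rideal (a * m - h).
pose B := rideal (P - j') (+) rideal (a * m - h).
pose J := rideal j.
have isoA : isomorphic (A (+) J) (rideal (m * a) (+) rideal (Q - j)).
  rewrite -iso_a split_a iso_h -iso_j /A -dsum_isoA.
  rewrite (dsum_isoC (rideal (Q - j))) (dsum_isoC (rideal (a * m - h)) J).
  reflexivity.
have isoB : isomorphic (B (+) J) (rideal (a * m) (+) rideal (P - j')).
  rewrite split_a iso_h -iso_j /B -dsum_isoA.
  rewrite (dsum_isoC (rideal (P - j'))) (dsum_isoC (rideal (a * m - h)) J).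
  reflexivity.
have isoAJJ : isomorphic (A (+) J (+) J) (rideal e).
  rewrite split_eQ -QE split_Q isoA -dsum_isoA.
  by rewrite (dsum_isoC (rideal (Q - j))); reflexivity.
have isoBJJ : isomorphic (B (+) J (+) J) (rideal e).
  rewrite split_eP -PE split_P isoB -iso_j -dsum_isoA.
  by rewrite (dsum_isoC (rideal (P - j'))); reflexivity.
have isoAB : isomorphic (A (+) J (+) J) (B (+) J (+) J).
  by rewrite isoAJJ isoBJJ; reflexivity.
have AJBJ : isomorphic (A (+) J) (B (+) J).
  by apply: sepR isoAB; do ?[apply: FP_dsum | exact: rideal_FP].
have ej : e * j = j by rewrite mulrA ez.
have je : j * e = j by rewrite -mulrA ye.
have ej' : e * j' = j' by rewrite mulrA ey.
have j'e : j' * e = j' by rewrite -mulrA ze.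
have [pp ep pe] := compl_idempotent ee jj ej je.
have [qq eq qe] := compl_idempotent ee j'j' ej' j'e.
have maj : m * a * j = 0 by rewrite -Qj mulrA -(mulrA m) aQ mulr0 mul0r.
have jma : j * (m * a) = 0.
  by rewrite -jQ -mulrA QE mulrBl ema mama subrr mulr0.
have amj' : a * m * j' = 0.
  by rewrite -Pj' mulrA PE mulrBr ame amam subrr mul0r.
have j'am : j' * (a * m) = 0 by rewrite -j'P -mulrA (mulrA P) Pa mul0r mulr0.
have split_p : isomorphic (rideal (e - j)) (A (+) J).
  rewrite isoA QE addrAC; apply: rideal_split => //.
    by rewrite mulrBl ema jma subr0.
  by rewrite mulrBr mae maj subr0.
have split_q : isomorphic (rideal (e - j')) (B (+) J).
  rewrite isoB PE addrAC; apply: rideal_split => //.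
    by rewrite mulrBl eam j'am subr0.
  by rewrite mulrBr ame amj' subr0.
have /isomorphic_rideal[] // : isomorphic (rideal (e - j)) (rideal (e - j')).
  by rewrite split_p split_q AJBJ; reflexivity.
move=> s [t [ts st ls lt]].
exact: (unit_regular_complete ee ey ye ez ze yz zy ts st ls lt).
Qed.

End SeparativityImpliesIdentity.

(** * From the identity to separativity *)

Section IdentityImpliesSeparativity.

Variable R : pzRingType.
Implicit Types a b c d e p q s t x y : R.

Lemma rideal_retract (M : lmodType R^c) (i : {linear M -> (R^c)^o})
    (r : {linear (R^c)^o -> M}) :
  cancel i r -> isomorphic (rideal (i (r (1 : R)) : R)) M.
Proof.
move=> iK; set p : R := i _.
have pE (x : R) : p * x = i (r x) by exact: esym (linear_scale_at (i \o r) x).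
have pi (u : M) : p * (i u : R) = i u by rewrite pE iK.
symmetry; apply: (@isomorphicI _ _ _ (to_ker (mem_rideal pi)) (r \o val)).
  by move=> u; exact: iK.
by move=> x; apply: val_inj; rewrite /= -pE ridealE.
Qed.

Lemma idem_idempotent (inv : R -> R) d : inner_inverse_op inv ->
  idem inv d * idem inv d = idem inv d.
Proof.
move=> invP; rewrite /idem.
have [p pE] : exists p, p = d * inv d by eexists.
have pp : p * p = p by rewrite pE mulrA invP.
have pd : p * d = d by rewrite pE invP.
have [q qE] : exists q, q = 1 - p by eexists.
have qp : q * p = 0 by rewrite qE mulrBl mul1r pp subrr.
have qd : q * d = 0 by rewrite qE mulrBl mul1r pd subrr.
rewrite -pE -qE mulrDl !mulrDr pp (mulrA p d) pd -!mulrA qp (mulrA q) qd.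
by rewrite mul0r !mulr0 !addr0.
Qed.

Lemma idem_id (inv : R -> R) e : inner_inverse_op inv -> e * e = e ->
  idem inv e = e.
Proof. by move=> invP ee; rewrite /idem mulrBr mulr1 mulrA ee addrC subrK. Qed.

(** The middle factor ebeaece is a product of ebe, eae and ece, so the
    parameters a, b, c may be thought of as elements of eRe. *)
Lemma xeltE (inv : R -> R) a b c d (e := idem inv d) (f := e * a * e) :
    inner_inverse_op inv ->
  xelt inv a b c d =
    (1 - f * inv f) * (e * b * e * f * (e * c * e)) * (1 - inv f * f) + (1 - e).
Proof.
move=> invP; have ee : e * e = e := idem_idempotent d invP.
rewrite /xelt -/e -/f; congr (_ * _ * _ + _).
by rewrite /f !mulrA -!(mulrA _ e e) ee.
Qed.

Section Cancel.

Variables (A B C Z : lmodType R^c).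

(** The maps needed below preserve the decomposition up to a move between the
    two copies of C: [k2] and [k3] select the copy, if any, that is sent to
    the first and to the second one. *)
Definition diag (M M' : lmodType R^c) (k1 : {linear M -> M'})
    (k2 k3 : {linear C (+) C -> C}) (k4 : {linear Z -> Z}) :
  {linear M (+) C (+) C (+) Z -> M' (+) C (+) C (+) Z} :=
  pair_lin (pair_lin (pair_lin (k1 \o fst \o fst \o fst)
    (k2 \o pair_lin (snd \o fst \o fst) (snd \o fst)))
    (k3 \o pair_lin (snd \o fst \o fst) (snd \o fst))) (k4 \o snd).

Definition in13 (M : lmodType R^c) : {linear M (+) C -> M (+) C (+) C (+) Z} :=
  pair_lin (pair_lin (pair_lin fst \0) snd) \0.
Definition pr13 (M : lmodType R^c) : {linear M (+) C (+) C (+) Z -> M (+) C} :=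
  pair_lin (fst \o fst \o fst) (snd \o fst).

Variable inv : R -> R.
Hypothesis invP : inner_inverse_op inv.
Hypothesis idP : separativity_identity inv.

(** Identify R with X = A + C1 + C2 + Z through f and with Y = B + C1 + C2 + Z
    through g, in such a way that the complements of Z agree; e is the
    projection to this common complement.  Let a carry C2 of X to C2 of Y and
    kill the rest, let c carry C1 to C2 in X, and b carry C2 to C1 in Y.  Then
    n = b a c carries C1 of X to C1 of Y, and N = n + (1 - e) also carries Z to
    Z.  The kernel of N is A + C2 and its cokernel is B + C2; they are
    isomorphic because N is unit-regular, being equal up to units to the
    element that the identity attaches to a, b, c and e. *)
Lemma identity_cancellation_below_self :
  isomorphic (A (+) C (+) C) (B (+) C (+) C) ->
  isomorphic (A (+) C (+) C (+) Z) (R^c)^o -> isomorphic (A (+) C) (B (+) C).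
Proof.
move=> /isomorphicP[h [h' [hK h'K]]] /isomorphicP[f [f' [fK f'K]]].
pose X := A (+) C (+) C (+) Z; pose Y := B (+) C (+) C (+) Z.
have [g [g' [gK [g'K [gh gh']]]]] : exists (g : {linear Y -> (R^c)^o})
    (g' : {linear (R^c)^o -> Y}), cancel g g' /\ cancel g' g /\
    (forall u, g' u = (h (f' u).1, (f' u).2)) /\
    (forall u, g u = f (h' u.1, u.2)).
  exists (f \o pair_lin (h' \o fst) snd), (pair_lin (h \o fst) snd \o f').
  split; [|split] => // u; rewrite /= ?fK /pair_lin /= ?h'K ?hK //;
    by rewrite -?surjective_pairing.
pose eX : {linear X -> X} := diag idfun fst snd \0.
pose eY : {linear Y -> Y} := diag idfun fst snd \0.
pose aT : {linear X -> Y} := diag \0 \0 snd \0.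
pose mT : {linear Y -> X} := diag \0 \0 snd \0.
pose cT : {linear X -> X} := diag \0 \0 fst \0.
pose bT : {linear Y -> Y} := diag \0 snd \0 \0.
pose nT : {linear X -> Y} := diag \0 fst \0 \0.
pose NT : {linear X -> Y} := diag \0 fst \0 idfun.
pose NT' : {linear Y -> X} := diag \0 fst \0 idfun.
pose e : R := f (eX (f' (1 : R))).
pose a : R := g (aT (f' (1 : R))).
pose m : R := f (mT (g' (1 : R))).
pose c : R := f (cT (f' (1 : R))).
pose b : R := g (bT (g' (1 : R))).
pose n : R := g (nT (f' (1 : R))).
pose N' : R := f (NT' (g' (1 : R))).
(* Products of elements of R are composites of the corresponding maps. *)
have mE (U V : lmodType R^c) (i : {linear U -> (R^c)^o}) (T : {linear V -> U})
    (r : {linear (R^c)^o -> V}) (x : R) :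
    (i (T (r (1 : R))) : R) * x = i (T (r x)).
  exact: esym (linear_scale_at (i \o T \o r) x).
have eE : e = g (eY (g' (1 : R))).
  have eXE u : eX u = (u.1, 0) by case: u => [[[]]].
  have eYE u : eY u = (u.1, 0) by case: u => [[[]]].
  by rewrite gh' eYE gh hK /e eXE.
have ee : e * e = e by rewrite mE fK.
have ea : e * a = a by rewrite eE mE gK.
have ae : a * e = a by rewrite mE fK.
have eb : e * b = b by rewrite eE mE gK.
have be : b * e = b by rewrite eE mE gK.
have ec : e * c = c by rewrite mE fK.
have ce : c * e = c by rewrite mE fK.
have nE : b * a * c = n by rewrite -mulrA mE mE gK fK.
have ama : a * m * a = a by rewrite -mulrA mE mE gK fK.
have amn : a * m * n = 0 by rewrite -mulrA mE mE gK fK; exact: (linear0 g).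
have nma : n * m * a = 0 by rewrite -mulrA mE mE gK fK; exact: (linear0 g).
pose N := n + (1 - e).
have NE : N = g (NT (f' (1 : R))).
  have one : (1 : R) = g (g' (1 : R)) by rewrite g'K.
  rewrite /N {1}one eE /n -linearB -linearD; congr (g _).
  rewrite gh; case: (f' _) => [[[x1 x2] x3] z]; case: (h _) => [[y1 y2] y3].
  congr (_, _, _, _); rewrite /= ?subrr ?addr0 //.
  by rewrite subr0 add0r.
have NN'N : N * N' * N = N by rewrite NE -mulrA mE mE gK fK.
have regN : unit_regular N.
  apply: (@unit_regular_change_inner_inverse _ e a (inv a) m n) => //;
    rewrite -?nE.
  - by rewrite !mulrA eb.
  - by rewrite -mulrA ce.
  have := unit_regular_identity invP idP a b c e.
  by rewrite xeltE // idem_id // !(ea, ae, eb, be, ec, ce).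
have [s [t [ts st]]] := unit_regular_ker_coker regN NN'N.
have isoA : isomorphic (rideal (1 - N' * N)) (A (+) C).
  rewrite NE mE gK.
  have -> : 1 - f (NT' (NT (f' (1 : R)))) =
      (f \o in13 A) ((pr13 A \o f') (1 : R)).
    rewrite -[X in X - _](f'K (1 : R)) -linearB; congr (f _).
    rewrite -[RHS]/(in13 A (pr13 A (f' (1 : R)))).
    case: (f' _) => [[[x1 x2] x3] z].
    by congr (_, _, _, _); rewrite /= ?subrr ?subr0.
  by apply: rideal_retract => -[u v]; rewrite /= fK.
have isoB : isomorphic (rideal (1 - N * N')) (B (+) C).
  rewrite NE mE fK.
  have -> : 1 - g (NT (NT' (g' (1 : R)))) =
      (g \o in13 B) ((pr13 B \o g') (1 : R)).
    rewrite -[X in X - _](g'K (1 : R)) -linearB; congr (g _).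
    rewrite -[RHS]/(in13 B (pr13 B (g' (1 : R)))).
    case: (g' _) => [[[x1 x2] x3] z].
    by congr (_, _, _, _); rewrite /= ?subrr ?subr0.
  by apply: rideal_retract => -[u v]; rewrite /= gK.
rewrite -isoA -isoB; exact: rideal_isomorphic ts st.
Qed.

End Cancel.
End IdentityImpliesSeparativity.

Theorem mainTheorem6 (R : pzRingType) (regR : regular_ring R) :
  (forall inv : R -> R,
     inner_inverse_op inv -> separativity_identity inv -> separative R)
  /\
  (separative R ->
     exists inv : R -> R, inner_inverse_op inv /\ separativity_identity inv).
Proof.
split=> [inv invP idP A B C [fA pA] [fB pB] [fC pC]|sepR].
  have regRc : regular_ring R^c.
    move=> a; have [b bE] := regR a; exists b.
    exact: etrans (@mulrA R a b a) bE.
  apply: (cancellation_from_below_self regRc _ (FP_fg_projective fA pA)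
    (FP_fg_projective fB pB) (FP_fg_projective fC pC)).
  by move=> A' B' C' Z; exact: (identity_cancellation_below_self invP idP).
(* The operation picks a unit as inner inverse whenever there is one. *)
pose good (a b : R) := a * b * a = a /\
  (unit_regular a -> exists v, b * v = 1 /\ v * b = 1).
have goodP a : exists b, good a b.
  case: (excluded_middle_informative (unit_regular a)) => [|nua].
    by move=> [u [v [uv [vu E]]]]; exists u; split=> // _; exists v.
  by have [b bE] := regR a; exists b.
pose inv a := proj1_sig (constructive_indefinite_description _ (goodP a)).
have inv_good a : good a (inv a).
  exact: proj2_sig (constructive_indefinite_description _ (goodP a)).
have invP : inner_inverse_op inv by move=> a; case: (inv_good a).
exists inv; split=> // a b c d /=; set x := xelt _ _ _ _ _.
have [v [uv vu]] : exists v, inv x * v = 1 /\ v * inv x = 1.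
  apply: (inv_good x).2; rewrite /x.
  rewrite xeltE //; set e := idem inv d.
  have ee : e * e = e := idem_idempotent d invP.
  have el y : e * (e * y * e) = e * y * e by rewrite !mulrA ee.
  have er y : e * y * e * e = e * y * e by rewrite -mulrA ee.
  exact: separative_xelt_unit_regular.
set u := inv x in uv vu *.
have uw : u * inv u = 1 by rewrite -[LHS]mulr1 -uv mulrA invP.
have wu : inv u * u = 1 by rewrite -[LHS]mul1r -vu -mulrA (mulrA u) invP.
by rewrite uw mul1r wu.
Qed.
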